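(* Let $A,B,C$ be finite sets, let $\lambda \in \mathrm{Exch}^\times(2^A,2^B)$, $\mu \in \mathrm{Exch}^\times(2^B,2^C)$, and suppose $\lambda \bullet \mu$ has type $(k,l)$. Then there exist disjoint sets $K,L \subseteq B$ with $|K| =k$, $|L| = l$ such that $$\lambda \bullet \mu = \lambda \circ \theta^{K,L}_B \circ \mu .\qquad ( * )$$ Furthermore, if $K,L \subseteq B$ are disjoint with $|K| =k$, $|L| = l$, and $\lambda \circ \theta^{K,L}_B \circ \mu \neq 0_{AC}$, then $( * )$ holds.
   Context: For a finite set $E$, $2^E$ is the set of subsets of $E$. Complements $\overline X$ are taken in the ambient set. $A\sqcup B$ is the disjoint union, and subsets of $A\sqcup B$ are identified with pairs of subsets of $A$ and $B$. $\mathrm{Rel}(2^A,2^B)$ is the set of all binary relations $\lambda \subseteq 2^A\times 2^B$; $X\mapsto_\lambda Y$ means $(X,Y)\in\lambda$; $0_{AB}$ is the empty relation. Composition is in diagrammatic order: $X\mapsto_{\lambda\circ\mu} Z$ iff there is $Y$ with $X\mapsto_\lambda Y$ and $Y\mapsto_\mu Z$. Given $X\mapsto_\lambda Y$ and $u,v\in A\sqcup B$, say $u$ and $v$ are exchangeable in $X\mapsto_\lambda Y$ if either $u=v$, or exactly one of $u,v$ belongs to $\overline X\sqcup Y$ and $X'\mapsto_\lambda Y'$, where $X' = X\,\triangle\,(\{u,v\}\cap A)$ and $Y'=Y\,\triangle\,(\{u,v\}\cap B)$. $\mathrm{Exch}(2^A,2^B)$ is the set of $\lambda\in\mathrm{Rel}(2^A,2^B)$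 such that for all $X\mapsto_\lambda Y$, $X'\mapsto_\lambda Y'$ and all $u\in\overline X\sqcup Y$ there exists $v\in\overline{X'}\sqcup Y'$ such that $u,v$ are exchangeable in $X\mapsto_\lambda Y$. (Equivalently, $\{\overline X\sqcup Y : X\mapsto_\lambda Y\}$ is empty or the set of bases of a matroid on $A\sqcup B$.) $\mathrm{Exch}^\times(2^A,2^B)=\mathrm{Exch}(2^A,2^B)\setminus\{0_{AB}\}$; this is the set of morphisms $A\to B$ of the category $\mathbf{Mtd}^\bullet$, whose composition is $\bullet$. Lax composition. Let $\lambda,\mu$ be non-empty relations in $\mathrm{Rel}(2^A,2^B)$, $\mathrm{Rel}(2^B,2^C)$. For $m\ge 0$, $X\mapsto_{\lambda\bullet_m\mu}Z$ iff there exist $Y,Y'\subseteq B$ with $X\mapsto_\lambda Y'$, $Y\mapsto_\mu Z$, $|Y\triangle Y'|=m$. With $m_0$ the smallest $m$ such that $\lambda\bullet_m\mu\neq 0_{AC}$, $\lambda\bullet\mu:=\lambda\bullet_{m_0}\mu$. For $k,l\ge0$, $X\mapsto_{\lambda\bullet_{k,l}\mu}Z$ iff there exist $Y,Y'\subseteq B$ with $X\mapsto_\lambda Y'$, $Y\mapsto_\mu Z$, $|Y\setminus Y'|=k$, $|Y'\setminus Y|=l$. $\lambda\bullet\mu$ has type $(k_0,l_0)$ if $(k_0,l_0)$ is the unique pair of non-negative integers with $k_0+l_0=m_0$ and $\lambda\bullet_{k_0,l_0}\mu\ne0_{AC}$. Partial identity relation: for disjoint $P,Q\subseteq B$, $\theta^{P,Q}_B\in\mathrm{Rel}(2^B,2^B)$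 is the relation with $X\mapsto Y$ iff $P=Y\setminus X$ and $Q=X\setminus Y$. *)

(* Defs.v *)
From mathcomp Require Import all_boot.

Set Implicit Arguments.
Unset Strict Implicit.
Unset Printing Implicit Defensive.

(* Rel(2^A, 2^B); X |->_r Y is (X, Y) \in r, and the empty relation is set0. *)
Definition Rel (A B : finType) : Type := {set {set A} * {set B}}.

Definition symdiff (T : finType) (X Y : {set T}) : {set T} :=
  (X :\: Y) :|: (Y :\: X).

(* The disjoint union of A and B is the type A + B; a pair of subsets (X, Y)
   is identified with the following subset of A + B. *)
Definition dunion (A B : finType) (X : {set A}) (Y : {set B}) : {set A + B} :=
  (inl @: X) :|: (inr @: Y).

Section Exchange.
Variables A B : finType.

(* [set a : A | inl a \in [set u; v]] is the intersection of {u, v} with A. *)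
Definition exchangeable (r : Rel A B) (X : {set A}) (Y : {set B})
    (u v : A + B) : Prop :=
  u = v \/
  ((u \in dunion (~: X) Y) (+) (v \in dunion (~: X) Y) /\
   (symdiff X [set a : A | inl a \in [set u; v]],
    symdiff Y [set b : B | inr b \in [set u; v]]) \in r).

Definition Exch (r : Rel A B) : Prop :=
  forall (X X' : {set A}) (Y Y' : {set B}),
    (X, Y) \in r -> (X', Y') \in r ->
  forall u : A + B, u \in dunion (~: X) Y ->
  exists v : A + B, v \in dunion (~: X') Y' /\ exchangeable r X Y u v.

Definition Exchx (r : Rel A B) : Prop := Exch r /\ r <> set0.

End Exchange.

Section Composition.
Variables A B C : finType.

Definition rel_comp (r : Rel A B) (s : Rel B C) : Rel A C :=
  [set p | [exists Y : {set B}, ((p.1, Y) \in r) && ((Y, p.2) \in s)]].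

Definition lax_comp_at (m : nat) (r : Rel A B) (s : Rel B C) : Rel A C :=
  [set p | [exists Y : {set B}, exists Y' : {set B},
    [&& (p.1, Y') \in r, (Y, p.2) \in s & #|symdiff Y Y'| == m]]].

Definition lax_comp_at2 (k l : nat) (r : Rel A B) (s : Rel B C) : Rel A C :=
  [set p | [exists Y : {set B}, exists Y' : {set B},
    [&& (p.1, Y') \in r, (Y, p.2) \in s, #|Y :\: Y'| == k & #|Y' :\: Y| == l]]].

(* The least m with lax_comp_at m r s != set0, for nonempty r and s (see
   lax_degP and lax_deg_min). Such an m is at most #|B|, so the minimum is
   taken over 'I_#|B|.+1; it is 0 by convention if r or s is empty. *)
Definition lax_deg (r : Rel A B) (s : Rel B C) : nat :=
  [arg min_(m < (ord0 : 'I_#|B|.+1) | lax_comp_at m r s != set0) (m : nat)].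

Definition lax_comp (r : Rel A B) (s : Rel B C) : Rel A C :=
  lax_comp_at (lax_deg r s) r s.

Definition lax_comp_has_type (r : Rel A B) (s : Rel B C) (k l : nat) : Prop :=
  [/\ k + l = lax_deg r s,
      lax_comp_at2 k l r s <> set0 &
      forall k' l' : nat, k' + l' = lax_deg r s ->
        lax_comp_at2 k' l' r s <> set0 -> k' = k /\ l' = l].

Lemma lax_comp_at_bound m (r : Rel A B) (s : Rel B C) :
  lax_comp_at m r s != set0 -> m <= #|B|.
Proof.
case/set0Pn=> p; rewrite inE => /existsP[Y /existsP[Y' /and3P[_ _ /eqP<-]]].
exact: max_card.
Qed.

Lemma lax_comp_at_ex (r : Rel A B) (s : Rel B C) :
  r != set0 -> s != set0 -> exists m, lax_comp_at m r s != set0.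
Proof.
move=> /set0Pn[[X Y'] rXY'] /set0Pn[[Y Z] sYZ].
exists #|symdiff Y Y'|; apply/set0Pn; exists (X, Z); rewrite inE /=.
by apply/existsP; exists Y; apply/existsP; exists Y'; rewrite rXY' sYZ eqxx.
Qed.

Lemma lax_degP (r : Rel A B) (s : Rel B C) :
  r != set0 -> s != set0 -> lax_comp_at (lax_deg r s) r s != set0.
Proof.
move=> r0 s0; have [m ms] := lax_comp_at_ex r0 s0.
have mB : m < #|B|.+1 by rewrite ltnS (lax_comp_at_bound ms).
rewrite /lax_deg /arg_min /extremum; case: pickP => [i /andP[] //|].
have [i Pi mini] := @arg_minnP _ (Ordinal mB)
  (fun i : 'I_#|B|.+1 => lax_comp_at i r s != set0) (@nat_of_ord _) ms.
by move/(_ i)/negbT/negP; case; rewrite /= Pi; apply/forall_inP.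
Qed.

Lemma lax_deg_min m (r : Rel A B) (s : Rel B C) :
  lax_comp_at m r s != set0 -> lax_deg r s <= m.
Proof.
move=> ms; have mB : m < #|B|.+1 by rewrite ltnS (lax_comp_at_bound ms).
rewrite /lax_deg /arg_min /extremum.
by case: pickP => [i /andP[_ /forall_inP/(_ (Ordinal mB) ms)] //|].
Qed.

End Composition.

Definition theta (B : finType) (P Q : {set B}) : Rel B B :=
  [set p | (P == p.2 :\: p.1) && (Q == p.1 :\: p.2)].

(* Main.v *)
(* Read lambda and mu as matroids on A + B and B + C with bases ~X + Y' and
   ~Y + Z.  For X |-> Y' and Y |-> Z, the set Y \ Y' consists of the elements of
   B lying in neither base b, c, and Y' \ Y is b :&: c.  In the union of the two
   matroids, |b :&: c| is least when b :|: c is a basis, and |Y \ Y'| is least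
   when b :|: c meets B in a maximal independent set; both happen at once, so
   minimizing the sum minimizes each.  Replacing the part in B of such a union
   by that of another one gives again a basis of the union, which allows
   prescribing Y \ Y' while keeping X and Z.  Deleting Y \ Y' and repeating the
   argument with the dual matroids then prescribes Y' \ Y. *)

Require Import Defs.
From mathcomp Require Import all_boot.
From mathcomp Require Import zify.

Set Implicit Arguments.
Unset Strict Implicit.
Unset Printing Implicit Defensive.

(** * Exchange families: cardinality, augmentation, duality, deletion *)

Section ExchangeFamilies.
Variable T : finType.
Implicit Types (F G : {set {set T}}) (b c I J S D : {set T}) (P : pred {set T}).

Definition exchange_family F := forall b b', b \in F -> b' \in F ->
  forall u, u \in b -> u \notin b' ->
  exists v, [/\ v \in b', v \notin b & v |: b :\ u \in F].

Definition indep F S := [exists b in F, S \subset b].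

(** The augmentation axiom, stated for any predicate so that it also covers unions of matroids. *)
Definition augmentable P := forall I J, P I -> P J -> #|I| < #|J| ->
  exists2 y, y \in J :\: I & P (y |: I).

Lemma indep_sub F I J : J \subset I -> indep F I -> indep F J.
Proof.
move=> JI /exists_inP[b bF Ib].
by apply/exists_inP; exists b => //; exact: subset_trans Ib.
Qed.

Lemma card_exchange b u v : u \in b -> v \notin b -> #|v |: b :\ u| = #|b|.
Proof.
by move=> ub vb; rewrite cardsU1 !inE (negPf vb) andbF /= (cardsD1 u b) ub.
Qed.

(** An exchange keeps the cardinality of [b] and shrinks [b :\: b'], until [b] lies inside [b']. *)
Lemma exchange_card_le F b b' :
  exchange_family F -> b \in F -> b' \in F -> #|b| <= #|b'|.
Proof.
move=> exF bF b'F; have [n] := ubnP #|b :\: b'|.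
elim: n b bF => // n IHn b bF lt_n.
have [/eqP|[u]] := set_0Vmem (b :\: b').
  by rewrite setD_eq0; exact: subset_leq_card.
rewrite inE => /andP[ub' ub].
have [v [vb' vb cF]] := exF _ _ bF b'F _ ub ub'.
rewrite -(card_exchange ub vb); apply: IHn => //.
rewrite ltnS in lt_n; apply: leq_trans lt_n; apply/proper_card/properP; split.
  apply/subsetP=> x; rewrite !inE; case: eqP => [->|_] /=; first by rewrite vb'.
  by case/and3P=> -> _ ->.
by exists u; rewrite !inE ub' ?ub // eqxx orbF; apply: contraNneq vb => <-.
Qed.

Lemma exchange_card F b b' :
  exchange_family F -> b \in F -> b' \in F -> #|b| = #|b'|.
Proof. by move=> exF bF b'F; apply/eqP; rewrite eqn_leq !(exchange_card_le exF). Qed.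

(** Exchanges towards [b1] push the basis [b2] over [J] into [J :|: b1]. If [I] had no augmentation,
    [b1 :\: b2] would lie in [I :\: J] and [J :\: I] in [b2 :\: b1]; since bases are equicardinal,
    this contradicts [#|I| < #|J|]. *)
Lemma exchange_augmentable F : exchange_family F -> augmentable (indep F).
Proof.
move=> exF I J /exists_inP[b1 b1F Ib1] /exists_inP[b2 b2F Jb2] ltIJ.
have [n] := ubnP #|b2 :\: (J :|: b1)|.
elim: n b2 b2F Jb2 => // n IHn b2 b2F Jb2 lt_n.
have [b2J|[x]] := set_0Vmem (b2 :\: (J :|: b1)); last first.
  rewrite !inE negb_or -andbA => /and3P[xJ xb1 xb2].
  have [v [vb1 vb2 cF]] := exF _ _ b2F b1F _ xb2 xb1.
  apply: (IHn _ cF).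
    apply/subsetP=> y yJ; rewrite !inE (subsetP Jb2) // andbT.
    by rewrite (contraNneq _ xJ) ?orbT // => <-.
  rewrite ltnS in lt_n; apply: leq_trans lt_n; apply/proper_card/properP; split.
    apply/subsetP=> y; rewrite !inE; case: eqP => [->|_] /=.
      by rewrite vb1 orbT.
    by case/and3P=> -> _ ->.
  exists x; rewrite !inE negb_or xJ xb1 ?xb2 //= eqxx orbF.
  by apply: contraNneq vb2 => <-.
have {}b2J : b2 \subset J :|: b1 by rewrite -setD_eq0 b2J.
have [/existsP[y /andP[yJI Iy]]|/existsPn noaug] :=
  boolP [exists y, (y \in J :\: I) && indep F (y |: I)]; first by exists y.
have Jb1 : J :&: b1 \subset I.
  apply/subsetP=> y /[!inE] /andP[yJ yb1]; apply/idPn => yI.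
  case/negP: (noaug y); rewrite inE yJ yI /=; apply/exists_inP.
  by exists b1 => //; rewrite subUset sub1set yb1.
(* Exchanging a bad [x] for some [v] of [b2] would give a basis over [v |: I] with [v] in
   [J :\: I]. *)
have b1I : b1 \subset I :|: b2.
  apply/subsetP=> x xb1; rewrite inE; apply/idPn; rewrite negb_or => /andP[xI xb2].
  have [v [vb2 vb1 cF]] := exF _ _ b1F b2F _ xb1 xb2.
  case/negP: (noaug v); rewrite inE.
  have := subsetP b2J _ vb2; rewrite inE (negPf vb1) orbF => ->.
  have -> /= : v \notin I by apply: contra vb1 => /(subsetP Ib1).
  apply/exists_inP; exists (v |: b1 :\ x) => //.
  rewrite setUS //; apply/subsetP=> y yI; rewrite !inE (subsetP Ib1) // andbT.
  by apply: contra xI => /eqP<-.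
have b12 : #|b1 :\: b2| <= #|I :\: J|.
  apply/subset_leq_card/subsetP=> x /[!inE] /andP[xb2 xb1].
  have := subsetP b1I _ xb1; rewrite inE (negPf xb2) orbF => ->.
  by rewrite andbT; apply: contra xb2 => /(subsetP Jb2).
have b21 : #|J :\: I| <= #|b2 :\: b1|.
  apply/subset_leq_card/subsetP=> x /[!inE] /andP[xI xJ].
  rewrite (subsetP Jb2) // andbT; apply: contra xI => xb1.
  by apply: (subsetP Jb1); rewrite inE xJ.
have := exchange_card exF b1F b2F.
have := cardsID b2 b1; have := cardsID b1 b2.
have := cardsID I J; have := cardsID J I.
rewrite (setIC b2 b1) (setIC I J); lia.
Qed.

Lemma augmentable_extend P I J : augmentable P -> P I -> P J -> #|I| <= #|J| ->
  exists S, [/\ P S, I \subset S, S \subset I :|: J & #|S| = #|J|].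
Proof.
move=> augP PI PJ; have [n] := ubnP (#|J| - #|I|).
elim: n I PI => // n IHn I PI lt_n.
rewrite leq_eqVlt => /orP[/eqP eqIJ|ltIJ]; first by exists I; rewrite subsetUl.
have [y /[!inE] /andP[yI yJ] PyI] := augP _ _ PI PJ ltIJ.
have cyI : #|y |: I| = #|I|.+1 by rewrite cardsU1 yI.
have [|| S [PS IS SIJ cS]] := IHn _ PyI; rewrite ?cyI //; first by lia.
exists S; split => //; first exact: subset_trans (subsetUr _ _) IS.
by apply: subset_trans SIJ _; rewrite -setUA subUset sub1set inE yJ orbT subxx.
Qed.

(** Here [u] lies in [b' :\: b]. Extending [u |: (b :&: b')] to a basis [S] inside [u |: b] leaves
    out a single [v]. As [S] contains [b :&: b'], this [v] is not in [b'], and [D :\: S] is the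
    required exchange. *)
Lemma exchange_dual F D : exchange_family F -> {in F, forall b, b \subset D} ->
  exchange_family [set D :\: b | b in F].
Proof.
move=> exF subD _ _ /imsetP[b bF ->] /imsetP[b' b'F ->] u.
rewrite !inE => /andP[ub uD]; rewrite uD andbT negbK => ub'.
have cbb' := exchange_card exF bF b'F.
have indb : indep F b by apply/exists_inP; exists b.
have indI : indep F (u |: (b :&: b')).
  by apply/exists_inP; exists b' => //; rewrite subUset sub1set ub' subsetIr.
have [v0 v0b v0b'] : exists2 v, v \in b & v \notin b'.
  apply/subsetPn; apply: contra ub => bb'.
  by have /eqP-> : b == b' by rewrite eqEcard bb' cbb' leqnn.
have cI : #|u |: (b :&: b')| <= #|b|.
  rewrite cardsU1 inE (negPf ub) /= add1n.
  rewrite -(cardsID b' b) -addn1 leq_add2l card_gt0.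
  by apply/set0Pn; exists v0; rewrite inE v0b v0b'.
have [S [/exists_inP[b3 b3F Sb3] IS SIb cS]] :=
  augmentable_extend (exchange_augmentable exF) indI indb cI.
have {Sb3} eS : S = b3.
  by apply/eqP; rewrite eqEcard Sb3 cS (exchange_card exF b3F bF) leqnn.
subst b3.
have uS : u \in S by apply: (subsetP IS); rewrite !inE eqxx.
have SU : S \subset u |: b.
  by apply: subset_trans SIb _; rewrite -setUA setUS // subUset subsetIl subxx.
have cD : #|(u |: b) :\: S| = 1.
  by rewrite cardsD (setIidPr SU) cardsU1 ub cS add1n subSnn.
have /eqP/cards1P[v Dv] := cD.
have : v \in (u |: b) :\: S by rewrite Dv set11.
rewrite !inE => /andP[vS uvb].
have vu : v != u by apply: contraNneq vS => ->.
rewrite (negPf vu) /= in uvb.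
have vD := subsetP (subD b bF) _ uvb.
exists v; rewrite !inE vD uvb andbT; split => //.
  apply: contra vS => vb'; apply: (subsetP IS).
  by rewrite !inE uvb vb' orbT.
apply/imsetP; exists S => //; apply/setP=> x.
have := congr1 (fun X : {set T} => x \in X) Dv.
rewrite !inE; have [->|xv] := eqVneq x v; first by rewrite vS vD.
have [->|xu] /= := eqVneq x u; first by rewrite uS.
move=> xSb; have xbS : (x \in S) = (x \in b).
  apply/idP/idP => [/(subsetP SU)|xb]; first by rewrite !inE (negPf xu).
  by move: xSb; rewrite xb andbT => /negbFE.
by rewrite xbS.
Qed.

(** Deletion of [K]: the incoming [v] belongs to [b'], which already avoids [K]. *)
Lemma exchange_avoid F K :
  exchange_family F -> exchange_family [set b in F | b :&: K == set0].
Proof.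
move=> exF b b'; rewrite !inE !setI_eq0 => /andP[bF bK] /andP[b'F b'K] u ub ub'.
have [v [vb' vb cF]] := exF _ _ bF b'F _ ub ub'.
exists v; split=> //; rewrite inE cF /= setI_eq0.
rewrite disjoints_subset subUset sub1set !inE (disjointFr b'K vb') /=.
by apply: subset_trans (subsetDl _ _) _; rewrite -disjoints_subset.
Qed.

(** * The union of two matroids *)

Definition union_indep F G S :=
  [exists b in F, exists c in G, S \subset b :|: c].

Lemma union_indepP F G S :
  reflect (exists b c, [/\ b \in F, c \in G & S \subset b :|: c])
          (union_indep F G S).
Proof.
apply: (iffP exists_inP) => [[b bF /exists_inP[c cG Sbc]]|[b [c [bF cG Sbc]]]].
  by exists b, c.
by exists b => //; apply/exists_inP; exists c.
Qed.

Lemma union_indepU F G I J :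
  indep F I -> indep G J -> union_indep F G (I :|: J).
Proof.
move=> /exists_inP[b bF Ib] /exists_inP[c cG Jc].
by apply/union_indepP; exists b, c; rewrite setUSS.
Qed.

Lemma union_indep_disjoint F G S : union_indep F G S ->
  exists I J, [/\ indep F I, indep G J, [disjoint I & J] & S = I :|: J].
Proof.
case/union_indepP=> b [c [bF cG Sbc]]; exists (S :&: b), (S :\: b); split.
- by apply/exists_inP; exists b => //; exact: subsetIr.
- by apply/exists_inP; exists c => //; rewrite subDset.
- rewrite -setI_eq0; apply/eqP/setP=> x; rewrite !inE.
  by case: (x \in b); rewrite ?andbF.
- by rewrite setID.
Qed.

Lemma union_indepC F G S : union_indep F G S = union_indep G F S.
Proof.
by apply/union_indepP/union_indepP => -[b [c [? ?]]] /[1!setUC] ?; exists c, b.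
Qed.

(* If an element y can be moved from J1 to I1 towards I2, doing so brings the
   decomposition of the smaller set closer to that of the larger one. *)
Lemma union_augmentable F G : exchange_family F -> exchange_family G ->
  augmentable (union_indep F G).
Proof.
move=> exF exG S1 S2 /union_indep_disjoint[I1 [J1 [indI1 indJ1 dis1 ->{S1}]]].
move=> /union_indep_disjoint[I2 [J2 [indI2 indJ2 dis2 ->{S2}]]].
have [n] := ubnP (#|I1 :&: J2| + #|J1 :&: I2|).
elim: n F G exF exG I1 J1 I2 J2 indI1 indJ1 dis1 indI2 indJ2 dis2 => // n IHn.
move=> F G exF exG I1 J1 I2 J2.
(* If [#|I1| >= #|I2|], then [#|J1| < #|J2|] by disjointness, and the two matroids trade roles. *)
wlog ltI : F G exF exG I1 J1 I2 J2 / #|I1| < #|I2|.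
  move=> IH indI1 indJ1 dis1 indI2 indJ2 dis2 lt_n lt12.
  have [ltI|leI] := ltnP #|I1| #|I2|; first exact: (IH F G).
  have /(IH G F exG exF J1 I1 J2 I2) : #|J1| < #|J2|.
    have := cardsUI I1 J1; have := cardsUI I2 J2.
    have /eqP-> : I1 :&: J1 == set0 by rewrite setI_eq0.
    have /eqP-> : I2 :&: J2 == set0 by rewrite setI_eq0.
    rewrite cards0; lia.
  rewrite !(setUC J1) !(setUC J2) ![[disjoint J1 & _]]disjoint_sym.
  rewrite [[disjoint J2 & _]]disjoint_sym addnC.
  case=> // y yI yU; exists y => //; by rewrite union_indepC.
move=> indI1 indJ1 dis1 indI2 indJ2 dis2 lt_n lt12.
have [y /[!inE] /andP[yI1 yI2] indy] := exchange_augmentable exF indI1 indI2 ltI.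
have [yJ1|yJ1] := boolP (y \in J1); last first.
  exists y; first by rewrite !inE negb_or yI1 yJ1 yI2.
  by rewrite setUA; exact: union_indepU.
(* Hence moving [y] leaves [I1 :&: J2] unchanged and removes [y] from [J1 :&: I2], so the measure
   drops. *)
have yJ2 : y \notin J2 by rewrite (disjointFr dis2 yI2).
have eU : (y |: I1) :|: (J1 :\ y) = I1 :|: J1.
  apply/setP=> x; rewrite !inE; case: eqP => [->|_] //=.
  by rewrite yJ1 orbT.
rewrite -eU; apply: (IHn F G) => //.
- exact: indep_sub (subsetDl _ _) indJ1.
- rewrite -setI_eq0; apply/eqP/setP=> x; rewrite !inE.
  case: eqP => //= _; case: (boolP (x \in I1)) => //= xI.
  by rewrite (disjointFr dis1 xI).
- have -> : (y |: I1) :&: J2 = I1 :&: J2.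
    apply/setP=> x; rewrite !inE; case: eqP => [->|//].
    by rewrite (negPf yJ2) !andbF.
  rewrite ltnS in lt_n; apply: leq_trans lt_n; rewrite ltn_add2l setIDAC.
  by apply/proper_card/properD1; rewrite inE yJ1.
- by rewrite eU.
Qed.

(** * Pairs of bases of minimal defect *)

(* In the application [B] is the common part of two ground sets. *)
Definition defect B b c := #|B :\: (b :|: c)| + #|b :&: c|.

Definition min_defect B F G b c := forall b' c',
  b' \in F -> c' \in G -> defect B b c <= defect B b' c'.

(** Both sides equal [#|B| + #|b| + #|c|], and bases are equicardinal. So minimizing the defect is
    maximizing the sum of the other two terms. *)
Lemma defect_card F G B b c b' c' : exchange_family F -> exchange_family G ->
  b \in F -> c \in G -> b' \in F -> c' \in G ->
  defect B b c + (#|B :&: (b :|: c)| + #|b :|: c|) =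
  defect B b' c' + (#|B :&: (b' :|: c')| + #|b' :|: c'|).
Proof.
move=> exF exG bF cG b'F c'G.
have := exchange_card exF bF b'F; have := exchange_card exG cG c'G.
have := cardsUI b c; have := cardsUI b' c'.
have := cardsID (b :|: c) B; have := cardsID (b' :|: c') B.
rewrite /defect; lia.
Qed.

Section MinDefect.
Variables (F G : {set {set T}}) (B : {set T}).
Hypotheses (exF : exchange_family F) (exG : exchange_family G).

Lemma union_indep_bases b c :
  b \in F -> c \in G -> union_indep F G (b :|: c).
Proof. by move=> bF cG; apply/union_indepP; exists b, c. Qed.

Lemma union_indep_sub I J :
  J \subset I -> union_indep F G I -> union_indep F G J.
Proof.
move=> JI /union_indepP[b [c [bF cG Ibc]]]; apply/union_indepP.
by exists b, c; split=> //; exact: subset_trans Ibc.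
Qed.

(** The trace on [B] of the second union is independent in the union matroid; it is extended to the
    size of the first union, unless it is already larger. *)
Lemma union_simultaneous b c b' c' :
  b \in F -> c \in G -> b' \in F -> c' \in G -> exists b3 c3,
  [/\ b3 \in F, c3 \in G, #|b :|: c| <= #|b3 :|: c3| &
      #|B :&: (b' :|: c')| <= #|B :&: (b3 :|: c3)|].
Proof.
move=> bF cG b'F c'G.
have [le_c|lt_c] := leqP #|B :&: (b' :|: c')| #|b :|: c|; last first.
  exists b', c'; split=> //; apply: leq_trans (ltnW lt_c) _.
  exact/subset_leq_card/subsetIr.
have indS := union_indep_sub (subsetIr B _) (union_indep_bases b'F c'G).
have [S [/union_indepP[b3 [c3 [b3F c3G S3]]] IS _ cS]] := augmentable_extend
  (union_augmentable exF exG) indS (union_indep_bases bF cG) le_c.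
exists b3, c3; split=> //; first by rewrite -cS subset_leq_card.
by apply: subset_leq_card; rewrite subsetI subsetIl (subset_trans IS).
Qed.

(** The pair [b, c] maximizes the sum of the two cardinalities. A competitor larger in one of them
    could be combined with [b, c] into a pair with a larger sum. *)
Lemma min_defect_maximal b c b' c' :
  b \in F -> c \in G -> min_defect B F G b c -> b' \in F -> c' \in G ->
  #|b' :|: c'| <= #|b :|: c| /\
  #|B :&: (b' :|: c')| <= #|B :&: (b :|: c)|.
Proof.
move=> bF cG minbc b'F c'G; split.
  have [b3 [c3 [b3F c3G]]] := union_simultaneous b'F c'G bF cG.
  have := minbc _ _ b3F c3G.
  have := defect_card B exF exG bF cG b3F c3G; lia.
have [b3 [c3 [b3F c3G]]] := union_simultaneous bF cG b'F c'G.
have := minbc _ _ b3F c3G.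
have := defect_card B exF exG bF cG b3F c3G; lia.
Qed.

(** Extend [B :&: (b :|: c)] by elements of [b1 :|: c1] to a set [S] of the size of [b1 :|: c1].
    Maximality of the trace prevents [S] from gaining elements in [B], so by counting it contains
    all of [b1 :|: c1] outside [B]. *)
Lemma min_defect_splice b c b1 c1 :
  b \in F -> c \in G -> b1 \in F -> c1 \in G ->
  min_defect B F G b c -> min_defect B F G b1 c1 -> exists b2 c2,
  [/\ b2 \in F, c2 \in G, min_defect B F G b2 c2,
      B :&: (b2 :|: c2) = B :&: (b :|: c) &
      (b2 :|: c2) :\: B = (b1 :|: c1) :\: B].
Proof.
move=> bF cG b1F c1G minbc minbc1.
have [max1 maxB] := min_defect_maximal bF cG minbc b1F c1G.
have [_ maxB1] := min_defect_maximal b1F c1G minbc1 bF cG.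
have indS := union_indep_sub (subsetIr B _) (union_indep_bases bF cG).
have [|S [/union_indepP[b2 [c2 [b2F c2G S2]]] IS SI cS]] := augmentable_extend
  (union_augmentable exF exG) indS (union_indep_bases b1F c1G).
  by apply: leq_trans maxB1 _; exact/subset_leq_card/subsetIr.
have [max2 maxB2] := min_defect_maximal b1F c1G minbc1 b2F c2G.
have eS : S = b2 :|: c2 by apply/eqP; rewrite eqEcard S2 cS.
subst S.
have eB : B :&: (b2 :|: c2) = B :&: (b :|: c).
  apply/esym/eqP; rewrite eqEcard subsetI subsetIl IS /=.
  by have [_] := min_defect_maximal bF cG minbc b2F c2G.
have eB1 : #|B :&: (b1 :|: c1)| = #|B :&: (b :|: c)|.
  by apply/eqP; rewrite eqn_leq maxB maxB1.
exists b2, c2; split=> //.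
  move=> b' c' b'F c'G; apply: leq_trans (minbc1 _ _ b'F c'G).
  have := defect_card B exF exG b1F c1G b2F c2G.
  by rewrite eB eB1 cS => /addIn->.
apply/eqP; rewrite eqEcard; apply/andP; split.
  apply/subsetP=> x /[1!inE] /andP[xB /(subsetP SI)].
  by rewrite !inE (negPf xB).
by rewrite !cardsD !(setIC _ B) eB eB1 cS.
Qed.

End MinDefect.

(** Outside [D1 :&: D2] no element of [J] lies in [D1], so the outer part of a union determines that
    of each member. *)
Lemma setD_common D1 D2 I J : I \subset D1 -> J \subset D2 ->
  I :\: (D1 :&: D2) = D1 :&: ((I :|: J) :\: (D1 :&: D2)).
Proof.
move=> /subsetP ID /subsetP JD; apply/setP=> x; rewrite !inE.
have [/ID->|_] := boolP (x \in I); first by rewrite andbT.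
by have [/JD->|_] := boolP (x \in J); case: (x \in D1).
Qed.

Lemma setD_dual D I B : I \subset D -> (D :\: B) :\: ((D :\: I) :\: B) = I :\: B.
Proof.
move=> /subsetP ID; apply/setP=> x; rewrite !inE.
case: (boolP (x \in I)) => [/ID->|_] /=; first by case: (x \in B).
by case: (x \in D); case: (x \in B).
Qed.

(** A first splice fixes the uncovered set [K]. A second one, on the complements of bases avoiding
    [K], fixes the overlap while [K] stays uncovered. *)
Lemma min_defect_prescribe F G D1 D2 b c b1 c1 (B := D1 :&: D2) :
  exchange_family F -> exchange_family G ->
  {in F, forall b, b \subset D1} -> {in G, forall c, c \subset D2} ->
  b \in F -> c \in G -> b1 \in F -> c1 \in G ->
  min_defect B F G b c -> min_defect B F G b1 c1 -> exists b3 c3,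
  [/\ b3 \in F /\ c3 \in G, b3 :&: c3 = b :&: c,
      B :\: (b3 :|: c3) = B :\: (b :|: c),
      b3 :\: B = b1 :\: B & c3 :\: B = c1 :\: B].
Proof.
move=> exF exG subF subG bF cG b1F c1G minbc minbc1.
have [b2 [c2 [b2F c2G minbc2 eB2 eD2]]] :=
  min_defect_splice exF exG bF cG b1F c1G minbc minbc1.
pose K := B :\: (b :|: c).
pose F' := [set x in F | x :&: K == set0].
pose G' := [set x in G | x :&: K == set0].
pose dF := [set D1 :\: x | x in F']; pose dG := [set D2 :\: x | x in G'].
(* Equal traces on [B] leave the same [K] uncovered, so both pairs survive the deletion of [K]. *)
have disK x y : x \in F -> y \in G -> B :&: (x :|: y) = B :&: (b :|: c) ->
    [disjoint x & K] /\ [disjoint y & K].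
  move=> _ _ /setP e; split; rewrite -setI_eq0; apply/eqP/setP=> z;
  have := e z; rewrite !inE.
    by case: (z \in x); case: (z \in D1); case: (z \in D2);
       case: (z \in b); case: (z \in c).
  by rewrite orbC; case: (z \in y); case: (z \in D1); case: (z \in D2);
     case: (z \in b); case: (z \in c).
have [bK cK] := disK b c bF cG erefl.
have [b2K c2K] := disK b2 c2 b2F c2G eB2.
have bF' : b \in F' by rewrite inE setI_eq0 bF.
have cG' : c \in G' by rewrite inE setI_eq0 cG.
have b2F' : b2 \in F' by rewrite inE setI_eq0 b2F.
have c2G' : c2 \in G' by rewrite inE setI_eq0 c2G.
have exdF : exchange_family dF.
  apply: exchange_dual; first exact: exchange_avoid.
  by move=> x /[!inE] /andP[xF _]; exact: subF.
have exdG : exchange_family dG.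
  apply: exchange_dual; first exact: exchange_avoid.
  by move=> x /[!inE] /andP[xG _]; exact: subG.
(* Complementation swaps the overlap and the uncovered part of [B], so it preserves the defect. *)
have dualU x y : x \in F -> y \in G ->
    B :\: ((D1 :\: x) :|: (D2 :\: y)) = x :&: y.
  move=> /subF/subsetP xD1 /subG/subsetP yD2; apply/setP=> z; rewrite !inE.
  have := xD1 z; have := yD2 z; case: (z \in x); case: (z \in y) => //=;
  by do ?[move/(_ isT)->]; case: (z \in D1); case: (z \in D2) => //= /(_ isT).
have dualI x y : (D1 :\: x) :&: (D2 :\: y) = B :\: (x :|: y).
  apply/setP=> z; rewrite !inE.
  by case: (z \in x); case: (z \in y); case: (z \in D1); case: (z \in D2).
have dualdef x y : x \in F -> y \in G ->
    defect B (D1 :\: x) (D2 :\: y) = defect B x y.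
  by move=> xF yG; rewrite /defect dualU // dualI addnC.
have dualmin x y : x \in F -> y \in G -> min_defect B F G x y ->
    min_defect B dF dG (D1 :\: x) (D2 :\: y).
  move=> xF yG minxy z t /imsetP[x' + ->{z}] /imsetP[y' + ->{t}].
  rewrite !inE => /andP[x'F _] /andP[y'G _].
  by rewrite !dualdef //; exact: minxy.
have [d [e [/imsetP[b3 b3F' ->{d}] /imsetP[c3 c3G' ->{e}] min3 eB3 eD3]]] :=
  min_defect_splice exdF exdG
    (imset_f _ bF') (imset_f _ cG') (imset_f _ b2F') (imset_f _ c2G')
    (dualmin _ _ bF cG minbc) (dualmin _ _ b2F c2G minbc2).
have [b3F b3K] : b3 \in F /\ [disjoint b3 & K] by move: b3F'; rewrite inE setI_eq0 => /andP.
have [c3G c3K] : c3 \in G /\ [disjoint c3 & K] by move: c3G'; rewrite inE setI_eq0 => /andP.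
have eI : b3 :&: c3 = b :&: c.
  have setDI U : B :\: U = B :\: (B :&: U) by rewrite setDIr setDv set0U.
  by rewrite -(dualU b3 c3) // -(dualU b c) // setDI eB3 -setDI.
(* The new bases avoid [K]; their defect is at most that of [b, c] and the overlaps agree, so
   nothing else is uncovered. *)
have eK : B :\: (b3 :|: c3) = K.
  apply/esym/eqP; rewrite eqEcard; apply/andP; split.
    apply/subsetP=> z zK; have zB := subsetP (subsetDl _ _) z zK.
    by rewrite in_setD zB in_setU (disjointFl b3K zK) (disjointFl c3K zK).
  have := min3 _ _ (imset_f _ bF') (imset_f _ cG').
  by rewrite !dualdef // /defect eI leq_add2r.
exists b3, c3; split=> //.
  (* Outside [B], the dual splice identifies [b3] with [b2], and the first splice identifies [b2]
     with [b1]. The case of [c3] is the same with [D1] and [D2] interchanged. *)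
  rewrite -(setD_dual _ (subF _ b3F)).
  rewrite (setD_common (subsetDl D1 b3) (subsetDl D2 c3)) eD3.
  rewrite -(setD_common (subsetDl D1 b2) (subsetDl D2 c2)).
  rewrite (setD_dual _ (subF _ b2F)) (setD_common (subF _ b2F) (subG _ c2G)) eD2.
  by rewrite -(setD_common (subF _ b1F) (subG _ c1G)).
rewrite -(setD_dual _ (subG _ c3G)) /B setIC.
rewrite (setD_common (subsetDl D2 c3) (subsetDl D1 b3)) setUC (setIC D2 D1) eD3.
rewrite setUC -/B /B (setIC D1 D2).
rewrite -(setD_common (subsetDl D2 c2) (subsetDl D1 b2)).
rewrite (setD_dual _ (subG _ c2G)) (setD_common (subG _ c2G) (subF _ b2F)).
rewrite setUC (setIC D2 D1) eD2 setUC /B (setIC D1 D2).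
by rewrite -(setD_common (subG _ c1G) (subF _ b1F)).
Qed.

End ExchangeFamilies.

(** * Transport along injections, and the bases of a relation *)

Lemma exchange_imset (T U : finType) (f : T -> U) (F : {set {set T}}) :
  injective f -> exchange_family F ->
  exchange_family [set f @: (b : {set T}) | b in F].
Proof.
move=> injf exF _ _ /imsetP[b bF ->] /imsetP[b' b'F ->] _ /imsetP[u ub ->].
rewrite mem_imset // => ub'.
have [v [vb' vb cF]] := exF _ _ bF b'F _ ub ub'.
exists (f v); rewrite !mem_imset //; split => //.
apply/imsetP; exists (v |: b :\ u) => //; apply/setP=> x.
apply/idP/idP.
  rewrite !inE => /orP[/eqP->|/andP[xu /imsetP[y yb ex]]].
    by apply: imset_f; rewrite !inE eqxx.
  subst x; apply: imset_f; rewrite !inE yb andbT.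
  by rewrite (inj_eq injf) in xu; rewrite xu orbT.
case/imsetP=> y /[!inE] /orP[/eqP-> ->|/andP[yu yb] ->]; first by rewrite eqxx.
by rewrite !(inj_eq injf) yu mem_imset ?yb ?orbT.
Qed.

Section DisjointUnion.
Variables A B : finType.
Implicit Types (X : {set A}) (Y : {set B}) (r : Rel A B).

Lemma in_dunion_inl X Y a : (inl a \in dunion X Y) = (a \in X).
Proof.
rewrite inE mem_imset; last by move=> ? ? [].
by rewrite orbC; case: imsetP => // -[].
Qed.

Lemma in_dunion_inr X Y b : (inr b \in dunion X Y) = (b \in Y).
Proof.
rewrite inE [X in _ || X]mem_imset; last by move=> ? ? [].
by case: imsetP => // -[].
Qed.

Definition in_dunionE := (in_dunion_inl, in_dunion_inr).

Definition rel_bases r : {set {set A + B}} :=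
  [set dunion (~: p.1) p.2 | p in r].

Lemma rel_basesP r X Y :
  (dunion (~: X) Y \in rel_bases r) = ((X, Y) \in r).
Proof.
apply/imsetP/idP => [[[X' Y'] /= r' /setP e]|]; last by exists (X, Y).
suff [-> ->] : X = X' /\ Y = Y' by [].
split; apply/setP=> z.
  by have := e (inl z); rewrite !in_dunionE !inE => /negb_inj.
by have := e (inr z); rewrite !in_dunionE.
Qed.

(** The case [u = v] is excluded since only [v] lies in the second base. Otherwise [v] is outside
    the first base, and toggling [u, v] in [(X, Y)] toggles them in the base, complementation
    commuting with symmetric difference. *)
Lemma Exch_exchange_family r : Exch r -> exchange_family (rel_bases r).
Proof.
move=> exr _ _ /imsetP[[X Y] rXY ->] /imsetP[[X' Y'] rXY' ->] u /= ub ub'.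
have [v [vb' [uv|[uvb rD]]]] := exr _ _ _ _ rXY rXY' _ ub.
  by rewrite uv vb' in ub'.
have vb : v \notin dunion (~: X) Y by move: uvb; rewrite ub; case: (v \in _).
exists v; split=> //; move: rD; rewrite -rel_basesP.
set b1 := dunion _ _; suff -> : b1 = v |: dunion (~: X) Y :\ u by [].
apply/setP=> z; rewrite {}/b1.
have -> : (z \in dunion (~: symdiff X [set a | inl a \in [set u; v]])
                        (symdiff Y [set b | inr b \in [set u; v]])) =
          (z \in dunion (~: X) Y) (+) (z \in [set u; v]).
  case: z => z; rewrite !in_dunionE ?in_setC !inE.
    by case: (z \in X); case: (_ == u); case: (_ == v).
  by case: (z \in Y); case: (_ == u); case: (_ == v).
rewrite in_set2 in_setU1 in_setD1.
have [->|zv] := eqVneq z v; first by rewrite (negPf vb) orbT.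
by have [->|zu] := eqVneq z u; [rewrite ub | rewrite addbF].
Qed.

End DisjointUnion.

Lemma card_symdiff (T : finType) (X Y : {set T}) :
  #|symdiff X Y| = #|X :\: Y| + #|Y :\: X|.
Proof.
rewrite cardsU; suff -> : (X :\: Y) :&: (Y :\: X) = set0 by rewrite cards0 subn0.
by apply/setP=> z; rewrite !inE; case: (z \in X); case: (z \in Y).
Qed.

(** * Lax composition on the common ground set *)

Section LaxComposition.
Variables A B C : finType.
Implicit Types (r : Rel A B) (s : Rel B C).

(** With [inl] on [A + B], this places both ground sets in [(A + B) + C] so that they meet exactly
    in the copy of [B]. *)
Definition tail_inj (z : B + C) : A + B + C :=
  match z with inl b => inl (inr b) | inr c => inr c end.

Lemma inl_injective (S T : Type) : injective (@inl S T).
Proof. by move=> ? ? []. Qed.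

Lemma tail_inj_injective : injective tail_inj.
Proof. by move=> [?|?] [?|?] //= [->]. Qed.

Let mid (b : B) : A + B + C := inl (inr b).

Let mid_inj : injective mid. Proof. by move=> ? ? []. Qed.

Let left_base (X : {set A}) (Y : {set B}) : {set A + B + C} :=
  inl @: dunion (~: X) Y.

Let right_base (Y : {set B}) (Z : {set C}) : {set A + B + C} :=
  tail_inj @: dunion (~: Y) Z.

Let in_left_base X Y z : (z \in left_base X Y) =
  match z with
  | inl (inl a) => a \notin X | inl (inr b) => b \in Y | inr _ => false
  end.
Proof.
case: z => [z|c].
  rewrite mem_imset; last exact: inl_injective.
  by case: z => z; rewrite in_dunionE ?in_setC.
by apply/imsetP=> -[].
Qed.

Let in_right_base Y Z z : (z \in right_base Y Z) =
  match z with
  | inl (inl _) => false | inl (inr b) => b \notin Y | inr c => c \in Z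
  end.
Proof.
case: z => [[a|b]|c].
- by apply/imsetP=> -[[]].
- by rewrite (mem_imset _ (inl b) tail_inj_injective) in_dunionE in_setC.
- by rewrite (mem_imset _ (inr c) tail_inj_injective) in_dunionE.
Qed.

Let left_ground : {set A + B + C} := inl @: setT.
Let right_ground : {set A + B + C} := tail_inj @: setT.

Let in_ground z : (z \in left_ground :&: right_ground) =
  if z is inl (inr _) then true else false.
Proof.
rewrite inE; case: z => [[a|b]|c].
- by rewrite andbC; apply/andP => -[/imsetP[[]]].
- by rewrite (mem_imset _ _ (@inl_injective _ _)) (mem_imset _ (inl b) tail_inj_injective) !inE.
- by apply/andP => -[/imsetP[]].
Qed.

Let uncovered X Y' Y Z :
  (left_ground :&: right_ground) :\: (left_base X Y' :|: right_base Y Z) =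
  mid @: (Y :\: Y').
Proof.
apply/setP=> z; rewrite in_setD in_ground in_setU in_left_base in_right_base.
case: z => [[a|b]|c]; rewrite ?andbF ?andbT.
- by apply/esym/imsetP => -[].
- by rewrite (mem_imset _ b mid_inj) !inE negb_or negbK.
- by apply/esym/imsetP => -[].
Qed.

Let overlap X Y' Y Z :
  left_base X Y' :&: right_base Y Z = mid @: (Y' :\: Y).
Proof.
apply/setP=> z; rewrite in_setI in_left_base in_right_base.
case: z => [[a|b]|c]; rewrite ?andbF.
- by apply/esym/imsetP => -[].
- by rewrite (mem_imset _ b mid_inj) !inE andbC.
- by apply/esym/imsetP => -[].
Qed.

Let defect_bases X Y' Y Z :
  defect (left_ground :&: right_ground) (left_base X Y') (right_base Y Z) =
  #|symdiff Y Y'|.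
Proof.
by rewrite /defect uncovered overlap !card_imset // card_symdiff.
Qed.

(** This is [min_defect_prescribe] read back on relations: pairs realizing [lax_deg] are those of
    minimal defect, and the parts outside [B] encode [X1] and [Z1]. *)
Lemma lax_comp_prescribe r s X Y' Y Z X1 Y1' Y1 Z1 : Exch r -> Exch s ->
  (X, Y') \in r -> (Y, Z) \in s -> #|symdiff Y Y'| = lax_deg r s ->
  (X1, Y1') \in r -> (Y1, Z1) \in s -> #|symdiff Y1 Y1'| = lax_deg r s ->
  exists Y2' Y2, [/\ (X1, Y2') \in r, (Y2, Z1) \in s,
    Y2 :\: Y2' = Y :\: Y' & Y2' :\: Y2 = Y' :\: Y].
Proof.
move=> exr exs rXY sYZ degY rX1Y1 sY1Z1 degY1.
pose F := [set inl @: (b : {set A + B}) | b in rel_bases r] : {set {set A + B + C}}.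
pose G := [set tail_inj @: (b : {set B + C}) | b in rel_bases s].
have exF : exchange_family F.
  exact: exchange_imset (@inl_injective _ _) (Exch_exchange_family exr).
have exG : exchange_family G.
  exact: exchange_imset tail_inj_injective (Exch_exchange_family exs).
have subF : {in F, forall b : {set A + B + C}, b \subset left_ground}.
  by move=> _ /imsetP[b _ ->]; apply: imsetS; apply: subsetT.
have subG : {in G, forall c : {set A + B + C}, c \subset right_ground}.
  by move=> _ /imsetP[c _ ->]; apply: imsetS; apply: subsetT.
have inF U V : (U, V) \in r -> left_base U V \in F.
  by move=> UV; apply: imset_f; rewrite rel_basesP.
have inG U V : (U, V) \in s -> right_base U V \in G.
  by move=> UV; apply: imset_f; rewrite rel_basesP.
have minP U V' V W : #|symdiff V V'| = lax_deg r s ->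
    min_defect (left_ground :&: right_ground) F G
      (left_base U V') (right_base V W).
  move=> deg b c /imsetP[b0 /imsetP[[U1 V1'] rUV ->{b0}] ->{b}].
  case/imsetP=> [c0 /imsetP[[V1 W1] sVW ->{c0}] ->{c}].
  rewrite !defect_bases deg; apply: lax_deg_min; apply/set0Pn.
  exists (U1, W1); rewrite inE; apply/existsP; exists V1.
  by apply/existsP; exists V1'; rewrite rUV sVW eqxx.
have [b [c [[bF cG] eI eU eL eR]]] := min_defect_prescribe exF exG subF subG
  (inF _ _ rXY) (inG _ _ sYZ) (inF _ _ rX1Y1) (inG _ _ sY1Z1)
  (minP X Y' Y Z degY) (minP X1 Y1' Y1 Z1 degY1).
case/imsetP: bF eI eU eL => b0 /imsetP[[X2 Y2'] r2 ->{b0}] ->{b}.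
case/imsetP: cG eR => c0 /imsetP[[Y2 Z2] s2 ->{c0}] ->{c} /=.
rewrite -!/(left_base _ _) -!/(right_base _ _) !uncovered !overlap.
move=> eR /(imset_inj mid_inj) eI /(imset_inj mid_inj) eU eL.
have eX : X2 = X1.
  apply/setP=> a; have := congr1 (fun S : {set _} => inl (inl a) \in S) eL.
  by rewrite /= !in_setD !in_ground !in_left_base => /negb_inj.
have eZ : Z2 = Z1.
  apply/setP=> a; have := congr1 (fun S : {set _} => inr a \in S) eR.
  by rewrite /= !in_setD !in_ground !in_right_base.
by exists Y2', Y2; rewrite -eX -eZ.
Qed.

Lemma rel_comp_thetaP r s K L X Z :
  reflect (exists Y' Y, [/\ (X, Y') \in r, (Y, Z) \in s,
             K = Y :\: Y' & L = Y' :\: Y])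
          ((X, Z) \in rel_comp (rel_comp r (theta K L)) s).
Proof.
rewrite inE; apply: (iffP existsP) => [[Y]|[Y' [Y [rXY sYZ eK eL]]]].
  rewrite inE => /andP[/existsP[Y' /andP[rXY]]].
  by rewrite inE => /andP[/eqP eK /eqP eL] sYZ; exists Y', Y.
exists Y; rewrite sYZ andbT inE; apply/existsP; exists Y'.
by rewrite rXY inE /= eK eL !eqxx.
Qed.

(** Any pair realizing the degree can be given the differences of [Y] and [Y']; conversely, a pair
    with these differences realizes the degree. *)
Lemma lax_comp_theta r s X Y' Y Z : Exch r -> Exch s ->
  (X, Y') \in r -> (Y, Z) \in s -> #|symdiff Y Y'| = lax_deg r s ->
  lax_comp r s = rel_comp (rel_comp r (theta (Y :\: Y') (Y' :\: Y))) s.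
Proof.
move=> exr exs rXY sYZ deg; apply/setP=> -[X1 Z1]; apply/idP/rel_comp_thetaP.
  rewrite inE => /existsP[Y1 /existsP[Y1' /and3P[rX1Y1 sY1Z1 /eqP deg1]]].
  have [Y2' [Y2 [r2 s2 eK eL]]] :=
    lax_comp_prescribe exr exs rXY sYZ deg rX1Y1 sY1Z1 deg1.
  by exists Y2', Y2.
case=> Y1' [Y1 [rX1Y1 sY1Z1 eK eL]].
rewrite inE; apply/existsP; exists Y1; apply/existsP; exists Y1'.
by rewrite rX1Y1 sY1Z1 /= card_symdiff -eK -eL -card_symdiff deg.
Qed.

End LaxComposition.

Theorem theorem7p1 (A B C : finType) (lambda : Rel A B) (mu : Rel B C)
    (k l : nat) (hlambda : Exchx lambda) (hmu : Exchx mu)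
    (htype : lax_comp_has_type lambda mu k l) :
  (exists K L : {set B},
     [/\ [disjoint K & L], #|K| = k, #|L| = l &
         lax_comp lambda mu = rel_comp (rel_comp lambda (theta K L)) mu]) /\
  (forall K L : {set B},
     [disjoint K & L] -> #|K| = k -> #|L| = l ->
     rel_comp (rel_comp lambda (theta K L)) mu <> set0 ->
     lax_comp lambda mu = rel_comp (rel_comp lambda (theta K L)) mu).
Proof.
case: hlambda hmu htype => exl _ [exm _] [deg ne _]; split.
  have /set0Pn[[X Z]] : lax_comp_at2 k l lambda mu != set0 by apply/eqP.
  rewrite inE => /existsP[Y /existsP[Y' /and4P[lXY mYZ /eqP cK /eqP cL]]].
  exists (Y :\: Y'), (Y' :\: Y); split=> //.
    rewrite -setI_eq0; apply/eqP/setP=> z; rewrite !inE.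
    by case: (z \in Y); case: (z \in Y').
  by apply: (lax_comp_theta exl exm lXY mYZ); rewrite card_symdiff cK cL.
(* A witness of non-emptiness has differences [K] and [L], hence realizes the degree [k + l]. *)
move=> K L _ cK cL /eqP/set0Pn[[X Z] /rel_comp_thetaP[Y' [Y [lXY mYZ eK eL]]]].
rewrite eK eL; apply: (lax_comp_theta exl exm lXY mYZ).
by rewrite card_symdiff -eK -eL cK cL.
Qed.
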